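(* Let $\epsilon \in [0,1]$ and let $p_{\text{site}}$ be the critical probability for standard site percolation on $\mathbb{Z}^2$. If $\epsilon > p_{\text{site}}$, then the Lightning Model with parameter $\epsilon$ has positive probability of strong percolation, i.e. $\mathbb{P}_\epsilon(\{0 \overset{\epsilon}{\leftrightarrow} \infty\}) > 0$.
   Context: Let $\overrightarrow{G}$ be the directed graph with vertex set $\mathbb{Z}^2$ and edge set $E = \{(a, a \pm e_i) : a \in \mathbb{Z}^2,\ i = 1,2\}$, where $e_1, e_2$ are the unit coordinate vectors; adjacent vertices are called neighbors. The space of vertex configurations is $\mathbb{V} = [0,1]^{\mathbb{Z}^2}$ with the product topology, its Borel $\sigma$-algebra, and Lebesgue product measure $\lambda$ (so the values $\phi_a$, $a\in\mathbb{Z}^2$, are i.i.d. uniform on $[0,1]$). The space of edge configurations is $\mathbb{E} = \{\bullet, \to\}^E$ with the product topology and Borel $\sigma$-algebra, where $\to$ means the directed edge is present (open) and $\bullet$ means it is absent. For $\epsilon \in [0,1]$ define $f_\epsilon : \mathbb{V} \to \mathbb{E}$ by: for $(a,b) \in E$, $f_\epsilon(\phi)_{(a,b)} = \;\to$ if $\phi_b < \phi_a + \epsilon$, and $\bullet$ otherwise. Let $\mathbb{P}_\epsilon = \lambda \circ f_\epsilon^{-1}$, a probability measure on $\mathbb{E}$. The Lightning Model with parameter $\epsilon$ is the probability space $\mathbb{E}$ with measure $\mathbb{P}_\epsilon$. A path from $a$ to $b$ is a finite sequence of distinct vertices $a = a_0, a_1, \dots, a_n = b$ such that each $(a_i,a_{i+1})$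 is an open edge; write $a \overset{\epsilon}{\to} b$ if such a path exists, and $a \overset{\epsilon}{\leftrightarrow} b$ if both $a \overset{\epsilon}{\to} b$ and $b \overset{\epsilon}{\to} a$. The strongly connected cluster of $a$ is $\{b \in \mathbb{Z}^2 : a \overset{\epsilon}{\leftrightarrow} b\}$. Strong percolation is the event $\{0 \overset{\epsilon}{\leftrightarrow} \infty\}$ that the strongly connected cluster of the origin $0$ is infinite. In standard site percolation on $\mathbb{Z}^2$ with parameter $p$, each vertex is open independently with probability $p$, and clusters are the connected components of the set of open vertices under (undirected) nearest-neighbor adjacency; $p_{\text{site}}$ is the supremum of those $p$ for which the cluster of the origin is almost surely finite. *)

(* Defs.v *)
From HB Require Import structures.
From mathcomp Require Import all_boot all_order all_algebra finmap.
From mathcomp Require Import all_classical all_reals all_analysis.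
From mathcomp Require Import measurable_realfun.

Set Implicit Arguments.
Unset Strict Implicit.
Unset Printing Implicit Defensive.
Import Order.TTheory GRing.Theory Num.Theory.
Import numFieldNormedType.Exports.
Local Open Scope classical_set_scope.
Local Open Scope ring_scope.

Notation borel T := (g_sigma_algebraType (@open T)).

Notation site := (int * int)%type.

Definition e1 : site := (1, 0).
Definition e2 : site := (0, 1).

Definition neighbor : rel site :=
  fun a b => b \in [:: a + e1; a - e1; a + e2; a - e2].

Notation edge := {e : site * site | neighbor e.1 e.2}.

Definition unit_interval (R : realType) : set R := [set` `[0, 1]].
Arguments unit_interval R : clear implicits.

Lemma unit_interval0 (R : realType) : (0 : R) \in unit_interval R.
Proof. by rewrite inE /unit_interval /= in_itv /= lexx ler01. Qed.

HB.instance Definition _ (R : realType) :=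
  isPointed.Build (unit_interval R) (SigSub (unit_interval0 R)).

(* Here [unit_interval R] is coerced to the subtype of [R] it carves out, with
   the subspace topology, and [bool] is discrete: [true] encodes a present edge
   in [edge_space], an open vertex in [site_space]. *)
Definition vertex_space (R : realType) : measurableType _ :=
  borel {ptws site -> unit_interval R}.
Definition edge_space : measurableType _ := borel {ptws edge -> bool}.
Definition site_space : measurableType _ := borel {ptws site -> bool}.

(* Under [mu], the family [X] is independent with common law [nu]. When the
   [X i] are the coordinates of a product space, this says that [mu] is the
   product of copies of [nu]. *)
Definition iid (R : realType) (I : choiceType) d (V : measurableType d)
    d' (T : measurableType d') (mu : probability V R)
    (nu : probability T R) (X : I -> V -> T) :=
  forall (s : {fset I}) (A : I -> set T), (forall i, measurable (A i)) ->
    (mu (\bigcap_(i in [set` s]) (X i @^-1` A i)) = \prod_(i <- s) nu (A i))%E.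

Definition vertex_value (R : realType) (a : site) (phi : vertex_space R) : R :=
  \val (phi a).

Definition uniform_product (R : realType)
    (lambda : probability (vertex_space R) R) :=
  iid lambda (uniform_prob (@ltr01 R)) (@vertex_value R).

Definition lightning_map (R : realType) (eps : R) (phi : vertex_space R) :
    edge_space :=
  fun e => vertex_value (val e).2 phi < vertex_value (val e).1 phi + eps.

Section product_of_bool.
Variable I : countType.

Definition cylinder (l : seq (I * bool)) : set {ptws I -> bool} :=
  [set w | all (fun x => w x.1 == x.2) l].

Lemma cylinder_nbhs (U : set {ptws I -> bool}) w : open U -> U w ->
  exists2 l, cylinder l w & cylinder l `<=` U.
Proof.
rewrite openE => /[apply].
case=> _ [[P sP <-] [V PV Vw] sU].
have [D sD DV] := sP _ PV.
have wit (B : set {ptws I -> bool}) : B \in D -> B w ->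
    exists i, forall w' : {ptws I -> bool}, w' i = w i -> B w'.
  move=> BD Bw; have := sD _ BD; rewrite inE => -[i _ [C oC CB]].
  by exists i => w' ww'; move: Bw; rewrite -CB /= ww'.
have /choice[g gP] (B : D) :
    exists i, forall w' : {ptws I -> bool}, w' i = w i -> val B w'.
  apply: wit; first exact: valP.
  by move: Vw; rewrite -DV; apply; exact: valP.
exists [seq (g B, w (g B)) | B <- enum {: D}].
  by apply/allP => _ /mapP[B _ ->] /=.
move=> w' /allP w'P; apply: sU; exists V => //.
suff : V w' by []; rewrite -DV => B BD.
have BD' : B \in D by [].
have /w'P /= /eqP :=
  map_f (fun B : D => (g B, w (g B))) (mem_enum {: D} [` BD']%fset).
exact: (gP [` BD']%fset).
Qed.

Lemma measurable_to_ptws_bool d (V : measurableType d)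
    (f : V -> borel {ptws I -> bool}) :
  (forall i, measurable_fun setT (fun v => f v i : bool)) ->
  measurable_fun setT f.
Proof.
move=> mf; apply: (@measurability _ _ V (borel {ptws I -> bool}) setT f
  (@open {ptws I -> bool}) erefl) => _ [U oU <-]; rewrite setTI.
have -> : U = \bigcup_(l in [set l | cylinder l `<=` U]) cylinder l.
  apply/seteqP; split=> [w Uw|w [l lU lw]]; last exact: lU.
  by have [l lw lU] := cylinder_nbhs oU Uw; exists l.
rewrite preimage_bigcup bigcup_mkcond.
apply: countable_bigcupT_measurable => // l; case: ifPn => _ //.
elim: l => [|[i b] l IHl].
  rewrite (_ : _ @^-1` _ = setT); first exact: measurableT.
  by apply/seteqP; split.
rewrite (_ : _ @^-1` _ = (fun v => f v i) @^-1` [set b] `&` f @^-1` cylinder l).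
  by apply: measurableI => //; rewrite -[X in measurable X]setTI; exact: mf.
by apply/seteqP; split=> v /=; rewrite /cylinder /=;
  [case/andP => /eqP|case=> -> ->; rewrite eqxx].
Qed.

End product_of_bool.

Lemma measurable_vertex_value (R : realType) a :
  measurable_fun setT (vertex_value a : vertex_space R -> R).
Proof.
apply: (measurability _ (RGenOpens.measurableE R)).
move=> _ [_ [x [y ->]] <-]; rewrite setTI; apply: sub_sigma_algebra.
have -> : vertex_value a @^-1` `]x, y[%classic =
    proj a @^-1` (set_val @^-1` `]x, y[%classic)
      :> set {ptws site -> unit_interval R} by [].
apply: open_comp; first by move=> ? _; exact: proj_continuous.
by apply: open_comp => // ? _; exact: initial_continuous.
Qed.

Lemma measurable_lightning_map (R : realType) (eps : R) :
  measurable_fun setT (@lightning_map R eps).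
Proof.
apply: measurable_to_ptws_bool => e.
apply: measurable_fun_ltr; first exact: measurable_vertex_value.
by apply: measurable_funD => //; exact: measurable_vertex_value.
Qed.

HB.instance Definition _ (R : realType) (eps : R) :=
  isMeasurableFun.Build _ _ _ _ (@lightning_map R eps)
    (measurable_lightning_map eps).

Definition lightning (R : realType) (lambda : probability (vertex_space R) R)
    (eps : R) : probability edge_space R :=
  distribution lambda (@lightning_map R eps).

(* [insub (a, b)] is [None] when [(a, b)] is not an edge of the lattice. *)
Definition open_edge (w : edge_space) : rel site :=
  fun a b => oapp w false (insub (a, b)).

Definition reaches (w : edge_space) (a b : site) :=
  exists p : seq site,
    [/\ uniq (a :: p), path (open_edge w) a p & last a p = b].

Definition strong_cluster (w : edge_space) (a : site) : set site :=
  [set b | reaches w a b /\ reaches w b a].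

Definition strong_percolation : set edge_space :=
  [set w | infinite_set (strong_cluster w 0)].

(* Empty when [a] is closed. *)
Definition site_cluster (w : site_space) (a : site) : set site :=
  [set b | exists p : seq site,
    [/\ all w (a :: p), path neighbor a p & last a p = b]].

Definition site_percolation_law (R : realType) (p : R)
    (mu : probability site_space R) :=
  iid mu (bernoulli_prob p) (fun (a : site) (w : site_space) => w a).

(* [site_percolation_law p] determines [mu], so the quantifier on [mu] only
   names the law of site percolation with parameter [p]. The set is bounded by
   1 and contains 0, hence [sup] is its least upper bound. *)
Definition p_site (R : realType) : R :=
  sup [set p | 0 <= p <= 1 /\ exists2 mu : probability site_space R,
    site_percolation_law p mu &
    {ae mu, forall w, finite_set (site_cluster w 0)}].

(* Main.v *)
Require Import Defs.
From mathcomp Require Import all_boot all_order all_algebra.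
From mathcomp Require Import all_classical all_reals all_analysis.
From HB Require Import structures.
From mathcomp Require Import measurable_realfun.
Import Order.TTheory GRing.Theory Num.Theory.
Local Open Scope classical_set_scope.
Local Open Scope ring_scope.

(** The model with parameter [eps] dominates site percolation with the same
    parameter.  Declare a vertex [a] open when [phi a < eps].  If [a] and [b]
    are open neighbors then [phi b < eps <= phi a + eps], because [phi a >= 0],
    and symmetrically; so an edge between two open vertices is present in both
    directions ([open_sites_lightning]).  Hence the site cluster of the origin
    lies inside its strongly connected cluster.  As the values [phi a] are
    independent and uniform on the unit interval, the open vertices form a
    site percolation with parameter exactly [eps] ([open_sites_law]).  If
    strong percolation had probability zero, the site cluster of the origin
    would be almost surely finite at parameter [eps], so [eps] would belong to
    the set of which [p_site] is the supremum, whence [eps <= p_site].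

    To compare probabilities, the two kinds of configurations are related by a
    map [both_open] from site to edge configurations that keeps the edges with
    two open endpoints.  Strong percolation of [both_open w] contains the event
    that the site cluster is infinite ([site_cluster_sub_strong]), so the
    measurability of the single event [strong_percolation] suffices.  That
    event is a countable combination of coordinate events, because reaching is
    a union over the countably many finite paths. *)

(** * Site clusters inside strongly connected clusters *)

Lemma neighbor_sym : symmetric neighbor.
Proof.
suff h a b : neighbor a b -> neighbor b a.
  by move=> a b; apply/idP/idP; exact: h.
rewrite /neighbor !inE.
by case/or4P=> /eqP ->; rewrite ?addrK ?subrK eqxx ?orbT.
Qed.

Lemma open_edgeE (w : edge_space) (a b : site) (ab : neighbor a b) :
  open_edge w a b = w (exist _ (a, b) ab).
Proof. by rewrite /open_edge insubT. Qed.

Lemma open_edge_neighbor (w : edge_space) a b : open_edge w a b -> neighbor a b.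
Proof. by rewrite /open_edge; case: insubP => // u + _ _. Qed.

(** Removing loops from a walk makes its vertices distinct, so it is enough
    to exhibit walks. *)
Lemma path_reaches (w : edge_space) a p :
  path (open_edge w) a p -> reaches w a (last a p).
Proof. by case/shortenP=> q qp uq _; exists q. Qed.

Lemma reaches_subrel (w w' : edge_space) a b :
  subrel (open_edge w) (open_edge w') -> reaches w a b -> reaches w' a b.
Proof. by move=> ww' [p [up pp lp]]; exists p; split=> //; exact: sub_path pp. Qed.

(** Adding edges can only enlarge the strongly connected clusters. *)
Lemma strong_percolation_subrel (w w' : edge_space) :
  subrel (open_edge w) (open_edge w') ->
  strong_percolation w -> strong_percolation w'.
Proof.
move=> ww'; apply: contra_not; apply: sub_finite_set => b [ab ba].
by split; exact: reaches_subrel ww' _.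
Qed.

Definition both_open (w : site_space) : edge_space :=
  fun e => w (val e).1 && w (val e).2.

Lemma open_edge_both_open (w : site_space) a b :
  open_edge (both_open w) a b = [&& neighbor a b, w a & w b].
Proof.
have [ab|ab] := boolP (neighbor a b); first by rewrite open_edgeE.
by apply: contraNF ab => /open_edge_neighbor.
Qed.

(** A path of open sites is a path of edges of [both_open w], and since the
    presence of those edges is symmetric it can be walked backwards as well. *)
Lemma site_cluster_sub_strong (w : site_space) a :
  site_cluster w a `<=` strong_cluster (both_open w) a.
Proof.
move=> b [p [wp np <-]].
have op : path (open_edge (both_open w)) a p.
  elim: p a wp np => //= c p IHp a /and3P[wa wc wp] /andP[ac np].
  by rewrite open_edge_both_open ac wa wc /= IHp //= wc.
split; first exact: path_reaches.
have := rev_path (open_edge (both_open w)) a p.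
rewrite (eq_path (e' := open_edge (both_open w))); last first.
  by move=> x y; rewrite !open_edge_both_open neighbor_sym [w x && _]andbC.
rewrite op => /path_reaches; case: p {wp np op} => //= c p.
by rewrite rev_cons last_rcons.
Qed.

(** * Measurability of strong percolation *)

(** Writes infinity as a countable intersection of countable unions, the form
    in which measurability can be checked. *)
Lemma infinite_set_pickle (T : countType) (A : set T) :
  infinite_set A <-> forall n, exists2 x, A x & (n <= pickle x)%N.
Proof.
split=> [Ainf n|h /finite_seqP[s As]].
  apply: contrapT => nA; apply: Ainf.
  apply: (@sub_finite_set _ _ (pickle @^-1` `I_n)) => [x Ax /=|].
    by rewrite ltnNge; apply/negP => nx; apply: nA; exists x.
  apply: finite_preimage (finite_II n) => x y _ _.
  exact: (pcan_inj pickleK).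
have [x] := h (\max_(x <- s) (pickle x).+1)%N.
rewrite As /= => xs; apply/negP; rewrite -ltnNge.
exact: leq_bigmax_seq.
Qed.

Lemma measurable_coordinate (I : countType) (i : I) :
  measurable [set w : borel {ptws I -> bool} | w i].
Proof.
apply: sub_sigma_algebra.
have -> : [set w | w i] = proj i @^-1` [set true] :> set {ptws I -> bool}.
  by [].
apply: open_comp; last exact: discrete_open.
by move=> ? _; exact: proj_continuous.
Qed.

Lemma measurable_open_edge a b :
  measurable [set w : edge_space | open_edge w a b].
Proof.
have [ab|ab] := boolP (neighbor a b).
  rewrite (_ : mkset _ = [set w : edge_space | w (exist _ (a, b) ab)]).
    exact: measurable_coordinate.
  by apply/seteqP; split=> w /=; rewrite open_edgeE.
rewrite (_ : mkset _ = set0); first exact: measurable0.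
by apply/seteqP; split=> w //= /open_edge_neighbor; apply/negP.
Qed.

Lemma measurable_open_path a p :
  measurable [set w : edge_space | path (open_edge w) a p].
Proof.
elim: p a => [|b p IHp] a /=.
  by rewrite (_ : mkset _ = setT)//; apply/seteqP.
rewrite (_ : mkset _ = [set w : edge_space | open_edge w a b] `&`
                       [set w : edge_space | path (open_edge w) b p]).
  by apply: measurableI => //; exact: measurable_open_edge.
by apply/seteqP; split=> w /=; [move/andP|move=> [-> ->]].
Qed.

Lemma measurable_reaches a b : measurable [set w : edge_space | reaches w a b].
Proof.
rewrite (_ : mkset _ = \bigcup_p
  if uniq (a :: p) && (last a p == b)
  then [set w : edge_space | path (open_edge w) a p] else set0).
  apply: countable_bigcupT_measurable => // p.
  by case: ifP => _; [exact: measurable_open_path|exact: measurable0].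
apply/seteqP; split=> w.
  by move=> [p [up pp lp]]; exists p; rewrite // up lp eqxx.
by move=> [p _]; case: ifP => // /andP[up /eqP lp] pp; exists p.
Qed.

Lemma measurable_strong_percolation : measurable strong_percolation.
Proof.
rewrite (_ : strong_percolation = \bigcap_n \bigcup_b
  if (n <= pickle (b : site))%N
  then [set w : edge_space | reaches w 0 b] `&`
       [set w : edge_space | reaches w b 0] else set0).
  apply: bigcapT_measurable => n.
  apply: countable_bigcupT_measurable => // b.
  case: ifP => _; last exact: measurable0.
  by apply: measurableI; exact: measurable_reaches.
apply/seteqP; split=> w.
  move=> /infinite_set_pickle winf n _.
  by have [b wb nb] := winf n; exists b; rewrite // nb.
move=> winf; apply/infinite_set_pickle => n.
by have [b _] := winf n I; case: ifP => // nb wb; exists b.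
Qed.

Lemma measurable_both_open : measurable_fun setT both_open.
Proof.
apply: measurable_to_ptws_bool => e.
have mc a : measurable_fun setT (fun w : site_space => w a : bool).
  by apply: (measurable_fun_bool true); rewrite setTI; exact: measurable_coordinate.
by apply: measurable_and; exact: mc.
Qed.

(** * Thresholding the vertex values *)

Section thresholding.
Variables (R : realType) (eps : R).

(** The carrier is [measurableTypeR R] so that the Borel structure used by
    [uniform_prob] is the one inferred for the domain. *)
Definition below (x : measurableTypeR R) : bool := x < eps.

Lemma measurable_below : measurable_fun setT below.
Proof. by apply: measurable_fun_ltr. Qed.

HB.instance Definition _ := isMeasurableFun.Build _ _ _ _ below measurable_below.

Definition open_sites (phi : vertex_space R) : site_space :=
  fun a => below (vertex_value a phi).

Lemma measurable_open_sites : measurable_fun setT open_sites.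
Proof.
apply: measurable_to_ptws_bool => a.
apply: measurableT_comp; first exact: measurable_below.
exact: measurable_vertex_value.
Qed.

HB.instance Definition _ :=
  isMeasurableFun.Build _ _ _ _ open_sites measurable_open_sites.

Lemma uniform_prob_below : 0 <= eps <= 1 ->
  distribution (uniform_prob (@ltr01 R)) below =1 bernoulli_prob eps.
Proof.
move=> /andP[eps0 eps1]; apply: eq_bernoulli.
rewrite /distribution /pushforward /= /uniform_prob integral_uniform_pdf.
rewrite (_ : _ `&` _ = `[0, eps[%classic); last first.
  apply/seteqP; split=> x; rewrite /= /below !in_itv /=.
    by move=> [-> /andP[->]].
  by move=> /andP[-> xe]; rewrite xe /= (le_trans (ltW xe)).
rewrite (eq_integral (fun=> 1%E)); last first.
  move=> x; rewrite inE /= in_itv /= => /andP[x0 xe].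
  by rewrite /uniform_pdf x0 (le_trans (ltW xe)) //= subr0 invr1.
rewrite integral_cst//= mul1e lebesgue_measure_itv /= lte_fin sube0.
by case: ltgtP eps0 => // <-.
Qed.

(** Independence passes to functions of single coordinates, so only the common
    law has to be computed: the threshold turns the uniform law on the unit
    interval into the Bernoulli law with parameter [eps]. *)
Lemma open_sites_law (lambda : probability (vertex_space R) R) :
  uniform_product lambda -> 0 <= eps <= 1 ->
  site_percolation_law eps (distribution lambda open_sites).
Proof.
move=> ulambda eps01 s A mA.
have mB a : measurable (below @^-1` A a) by exact: measurable_funPTI.
have := ulambda s (fun a => below @^-1` A a) mB.
rewrite /distribution /pushforward /= => lambdaE.
rewrite [LHS]lambdaE; apply: eq_bigr => a _.
by rewrite -(uniform_prob_below eps01).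
Qed.

(** Both [phi a] and [phi b] lie in an interval of length [eps] starting at 0,
    so neither can exceed the other by [eps] or more. *)
Lemma open_sites_lightning (phi : vertex_space R) :
  subrel (open_edge (both_open (open_sites phi)))
         (open_edge (lightning_map eps phi)).
Proof.
move=> a b; rewrite open_edge_both_open => /and3P[ab _ phib].
rewrite open_edgeE /lightning_map /=; apply: (lt_le_trans phib).
rewrite lerDr /vertex_value; have := valP (phi a).
by rewrite inE /unit_interval /= in_itv /= => /andP[].
Qed.

End thresholding.

Theorem proposition3p6 (R : realType)
    (lambda : probability (vertex_space R) R) (eps : R) :
  uniform_product lambda ->
  0 <= eps <= 1 ->
  p_site R < eps ->
  (0 < lightning lambda eps strong_percolation)%E.
Proof.
move=> ulambda eps01; rewrite lt0e measure_ge0 andbT.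
(* If strong percolation were null, [eps] would be a subcritical parameter. *)
apply: contraTneq => null; rewrite -leNgt.
apply: ub_le_sup; first by exists 1 => p [/andP[]].
split=> //; exists (distribution lambda (open_sites R eps)).
  exact: open_sites_law.
have mSP : measurable (both_open @^-1` strong_percolation).
  rewrite -[X in measurable X]setTI.
  by apply: measurable_both_open => //; exact: measurable_strong_percolation.
(* This event stands in for the infinite site cluster: it contains it, and
   [lambda] bounds it by the null event of the model. *)
exists (both_open @^-1` strong_percolation); split=> //.
- apply/eqP; rewrite eq_le measure_ge0 andbT -null.
  rewrite /lightning /distribution /pushforward /=.
  apply: (le_measure lambda); rewrite ?inE.
  + exact: measurable_funPTI.
  + by apply: measurable_funPTI; exact: measurable_strong_percolation.
  + by move=> phi; apply: strong_percolation_subrel; exact: open_sites_lightning.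
- move=> w; apply: contra_not.
  exact: sub_finite_set (site_cluster_sub_strong w 0).
Qed.
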